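(* Let $\mathbb{D}$ be the open unit disk in the complex plane $\mathbb{C}$. For any $t>0$, the function \[ K_t(\lambda,\mu)=\exp\left(-t\left|\frac{\lambda-\mu}{1-\overline{\mu}\lambda}\right|^2\right)\quad(\lambda,\mu\in\mathbb{D}) \] is strictly positive definite on $\mathbb{D}\times\mathbb{D}$.
   Context: A function $k:X\times X\to\mathbb{C}$ on a set $X$ is called a kernel if $k(y,x)=\overline{k(x,y)}$ for all $x,y\in X$ and $\sum_{i,j=1}^n c_i\overline{c_j}k(x_i,x_j)\ge 0$ for any $n\ge 1$, any $x_1,\ldots,x_n\in X$ and any $(c_1,\ldots,c_n)\in\mathbb{C}^n$. A kernel $k$ is strictly positive (strictly positive definite) if $\sum_{i,j=1}^n c_i\overline{c_j}k(x_i,x_j)>0$ for any $n\ge1$, any $n$ distinct points $x_1,\ldots,x_n\in X$ and any $(c_1,\ldots,c_n)\in\mathbb{C}^n\setminus\{\mathbf{0}\}$. *)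

(* Defs.v *)
From mathcomp Require Import all_boot all_order all_algebra.
From mathcomp Require Import complex.
From mathcomp Require Import reals sequences exp.

Set Implicit Arguments.
Unset Strict Implicit.
Unset Printing Implicit Defensive.

Import Order.TTheory GRing.Theory Num.Theory.
Local Open Scope ring_scope.

(* The order on R[i] is partial: [0 <= z] (resp. [0 < z]) says that [z] is a
   nonnegative (resp. positive) real number, so the inequalities below include
   the fact that the quadratic form is real-valued. *)

Definition is_kernel (R : realType) (X : Type) (k : X -> X -> R[i]) : Prop :=
  (forall x y : X, k y x = (k x y)^*) /\
  (forall (n : nat) (x : 'I_n -> X) (c : 'rV[R[i]]_n), (1 <= n)%N ->
     0 <= \sum_(i < n) \sum_(j < n) c 0 i * (c 0 j)^* * k (x i) (x j)).

Definition strictly_positive_definite (R : realType) (X : Type)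
    (k : X -> X -> R[i]) : Prop :=
  is_kernel k /\
  (forall (n : nat) (x : 'I_n -> X) (c : 'rV[R[i]]_n), (1 <= n)%N ->
     injective x -> c != 0 ->
     0 < \sum_(i < n) \sum_(j < n) c 0 i * (c 0 j)^* * k (x i) (x j)).

Definition unit_disk (R : realType) : Type := {z : R[i] | `|z| < 1}.

(* The norm [`|z|] of [z : R[i]] is itself in R[i], with zero imaginary part;
   its real part is the modulus of [z] as an element of R. *)
Definition modulus (R : realType) (z : R[i]) : R := complex.Re `|z|.

Definition Kt (R : realType) (t : R) (lambda mu : unit_disk R) : R[i] :=
  let l := val lambda in
  let m := val mu in
  (expR (- t * modulus ((l - m) / (1 - m^* * l)) ^+ 2))%:C%C.

(* Main.v *)
Require Import Defs.
From mathcomp Require Import all_boot all_order all_algebra.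
From mathcomp Require Import complex.
From mathcomp Require Import reals sequences exp.
From mathcomp Require Import boolp classical_sets topology normedtype.
From mathcomp Require Import ring.

Import Order.TTheory GRing.Theory Num.Theory.
Import numFieldNormedType.Exports.
Local Open Scope ring_scope.

(** Since [1 - |(l - m) / (1 - m^* l)|^2 = (1 - |l|^2) (1 - |m|^2) / |1 - m^* l|^2],
    the kernel is [e^-t exp(t P)], where [P] is the squared modulus of the Szego
    kernel weighted by [1 - |l|^2] and [1 - |m|^2].  Expanding the Szego kernel
    geometrically and the exponential as a power series exhibits [exp(t P)] as
    a limit of finite sums of rank one kernels, all of which contain the terms
    [f_p(l) f_p(m)^*] with [f_p(l) = sqrt t (1 - |l|^2) l^p], [p < n].  For [n]
    distinct points a Vandermonde determinant shows that these [n] terms alone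
    make the quadratic form positive, and this lower bound survives the limit. *)

(** * Hermitian forms and Gram kernels *)

Definition hform {C : numClosedFieldType} {I : finType} (c : I -> C)
    (A : I -> I -> C) : C :=
  \sum_i \sum_j c i * (c j)^* * A i j.

(** Positivity is carried by an explicit finite list of features: closure under entrywise products
    is then elementary, which it is not for positive semidefiniteness. *)
Definition gram {C : numClosedFieldType} {I : finType} (A : I -> I -> C) :=
  exists s : seq (I -> C), forall i j, A i j = \sum_(f <- s) f i * (f j)^*.

Section Gram.
Context {C : numClosedFieldType} {I : finType}.
Implicit Types (A B : I -> I -> C) (c f u : I -> C).

Lemma eq_gram A B : (forall i j, A i j = B i j) -> gram A -> gram B.
Proof. by move=> AB [s As]; exists s => i j; rewrite -AB. Qed.

Lemma gram_rank1 f : gram (fun i j => f i * (f j)^*).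
Proof. by exists [:: f] => i j; rewrite big_seq1. Qed.

Lemma gram_cst (a : C) : 0 <= a -> gram (fun _ _ : I => a).
Proof.
move=> a_ge0; apply: eq_gram (gram_rank1 (fun=> sqrtC a)) => _ _.
by rewrite geC0_conj ?sqrtC_ge0// -expr2 sqrtCK.
Qed.

Lemma gramD A B : gram A -> gram B -> gram (fun i j => A i j + B i j).
Proof.
move=> [s As] [r Br]; exists (s ++ r) => i j.
by rewrite big_cat /= As Br.
Qed.

(** Schur product theorem: the pointwise products of a feature of [A] with a feature of [B] are
    features of the product. *)
Lemma gramM A B : gram A -> gram B -> gram (fun i j => A i j * B i j).
Proof.
move=> [s As] [r Br].
exists [seq (fun i => f i * g i) | f <- s, g <- r] => i j.
rewrite big_allpairs_dep As Br big_distrlr /=.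
by apply: eq_bigr => f _; apply: eq_bigr => g _; rewrite rmorphM mulrACA.
Qed.

Lemma gramX A n : gram A -> gram (fun i j => A i j ^+ n).
Proof.
move=> gA; elim: n => [|n IHn]; first exact: gram_cst ler01.
by apply: eq_gram (gramM _ _ gA IHn) => i j; rewrite exprS.
Qed.

Lemma gram_sum (K : Type) (r : seq K) (P : pred K) (F : K -> I -> I -> C) :
  (forall k, P k -> gram (F k)) -> gram (fun i j => \sum_(k <- r | P k) F k i j).
Proof.
move=> gF; elim: r => [|k r IHr].
  by exists [::] => i j; rewrite !big_nil.
case Pk: (P k); last by apply: eq_gram IHr => i j; rewrite big_cons Pk.
by apply: eq_gram (gramD _ _ (gF _ Pk) IHr) => i j; rewrite big_cons Pk.
Qed.

Lemma hform_rank1 c f :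
  hform c (fun i j => f i * (f j)^*) = `|\sum_i c i * f i| ^+ 2.
Proof.
rewrite normCK rmorph_sum big_distrlr /=.
by apply: eq_bigr => i _; apply: eq_bigr => j _; rewrite rmorphM mulrACA.
Qed.

Lemma hform_sum c (K : Type) (r : seq K) (P : pred K) (F : K -> I -> I -> C) :
  hform c (fun i j => \sum_(k <- r | P k) F k i j) =
  \sum_(k <- r | P k) hform c (F k).
Proof.
rewrite exchange_big; apply: eq_bigr => i _.
by rewrite exchange_big; apply: eq_bigr => j _; rewrite mulr_sumr.
Qed.

Lemma hformB c A B :
  hform c (fun i j => A i j - B i j) = hform c A - hform c B.
Proof.
rewrite -sumrB; apply: eq_bigr => i _; rewrite -sumrB.
by apply: eq_bigr => j _; rewrite mulrBr.
Qed.

Lemma hformZ c (a : C) A : hform c (fun i j => a * A i j) = a * hform c A.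
Proof.
rewrite mulr_sumr; apply: eq_bigr => i _; rewrite mulr_sumr.
by apply: eq_bigr => j _; rewrite mulrCA.
Qed.

Lemma eq_hform c A B : (forall i j, A i j = B i j) -> hform c A = hform c B.
Proof. by move=> AB; apply: eq_bigr => i _; apply: eq_bigr => j _; rewrite AB. Qed.

Lemma hform_ge0 c A : gram A -> 0 <= hform c A.
Proof.
move=> [s As]; rewrite (eq_hform _ _ _ As) hform_sum.
by apply: sumr_ge0 => f _; rewrite hform_rank1 exprn_ge0.
Qed.

Definition szego u N i j : C := \sum_(p < N) (u i * (u j)^*) ^+ p.

Lemma gram_szegoB u m N : (m <= N)%N ->
  gram (fun i j => szego u N i j - szego u m i j).
Proof.
move=> /subnKC <-; set k := (N - m)%N.
have gk : gram (fun i j => \sum_(p < k) (u i * (u j)^*) ^+ (m + p)).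
  by apply: gram_sum => p _; apply: gramX; apply: gram_rank1.
apply: eq_gram gk => i j.
by rewrite /szego big_split_ord /= addrAC subrr add0r.
Qed.

Lemma conj_szego u N i j : (szego u N i j)^* = szego (fun i => (u i)^*) N i j.
Proof.
by rewrite rmorph_sum; apply: eq_bigr => p _; rewrite rmorphXn rmorphM.
Qed.

Lemma gram_szego u N : gram (szego u N).
Proof.
apply: eq_gram (gram_szegoB u 0 N isT) => i j.
by rewrite /szego big_ord0 subr0.
Qed.

(* s s^* - s_m = s (s - 1)^* + (s - s_m), where s is the N-th partial sum,
   s_m the m-th one and 1 the first. *)
Lemma gram_normsq_szegoB (f u : I -> C) m N : (m <= N)%N -> (0 < N)%N ->
  gram (fun i j => f i * (f j)^* * (szego u N i j * (szego u N i j)^*)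
                 - \sum_(p < m) (f i * u i ^+ p) * (f j * u j ^+ p)^*).
Proof.
move=> le_mN N_gt0.
have gE : gram (fun i j => f i * (f j)^* * (szego u N i j *
    (szego (fun i => (u i)^*) N i j - szego (fun i => (u i)^*) 1 i j) +
    (szego u N i j - szego u m i j))).
  apply: gramM; first exact: gram_rank1.
  apply: gramD; last exact: gram_szegoB.
  by apply: gramM; [exact: gram_szego|exact: gram_szegoB].
apply: eq_gram gE => i j; rewrite conj_szego.
have -> : \sum_(p < m) f i * u i ^+ p * (f j * u j ^+ p)^* =
    f i * (f j)^* * szego u m i j.
  rewrite mulr_sumr; apply: eq_bigr => p _.
  by rewrite rmorphM rmorphXn mulrACA exprMn.
have -> : szego (fun i => (u i)^*) 1 i j = 1 by rewrite /szego big_ord1 expr0.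
by ring.
Qed.

Lemma gram_normsq_szego (f u : I -> C) N :
  gram (fun i j => f i * (f j)^* * (szego u N i j * (szego u N i j)^*)).
Proof.
apply: gramM; first exact: gram_rank1.
apply: gramM; first exact: gram_szego.
apply: eq_gram (gram_szego (fun i => (u i)^*) N) => i j.
by rewrite conj_szego.
Qed.

(** The term k = 1, present because 1 < [M], is [A] itself and absorbs [B]; every other term is a
    nonnegative multiple of a power of [A]. *)
Lemma gram_exp_sumB A B M : gram A -> gram (fun i j => A i j - B i j) ->
  (1 < M)%N ->
  gram (fun i j => \sum_(k < M) A i j ^+ k / k`!%:R - B i j).
Proof.
move=> gA gAB M_gt1.
have gE : gram (fun i j => (A i j - B i j) +
    \sum_(k < M | k != Ordinal M_gt1) A i j ^+ k * k`!%:R^-1).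
  apply: gramD => //; apply: gram_sum => k _; apply: gramM; first exact: gramX.
  by apply: gram_cst; rewrite invr_ge0 ler0n.
apply: eq_gram gE => i j.
by rewrite [in RHS](bigD1 (Ordinal M_gt1)) //= expr1 divr1 addrAC.
Qed.

End Gram.

(** If all the moments vanished, the vector (c_i f_i) would be killed by the Vandermonde matrix of
    the distinct nodes u_i, which is invertible; as no f_i is 0, every c_i would be 0. *)
Lemma moments_gt0 (C : numClosedFieldType) n (c f u : 'I_n -> C) :
  injective u -> (forall i, f i != 0) -> (exists i, c i != 0) ->
  0 < \sum_(p < n) `|\sum_i c i * (f i * u i ^+ p)| ^+ 2.
Proof.
move=> u_inj f_neq0 [i0 ci0].
have S_ge0 (p : 'I_n) : true -> 0 <= `|\sum_i c i * (f i * u i ^+ p)| ^+ 2.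
  by rewrite exprn_ge0.
rewrite lt0r sumr_ge0 // andbT; apply: contraNneq ci0 => S0.
pose V := Vandermonde n (\row_i u i); pose d := \col_i (c i * f i).
have V_unit : V \in unitmx.
  rewrite unitmxE det_Vandermonde unitfE; apply/prodf_neq0 => i _.
  apply/prodf_neq0 => j lt_ij; rewrite !mxE subr_eq0.
  by apply/eqP => /u_inj eq_ji; rewrite eq_ji ltnn in lt_ij.
have Vd : V *m d = 0.
  apply/colP => p; rewrite !mxE.
  have /eqP := psumr_eq0P S_ge0 S0 (i := p) isT.
  rewrite expf_eq0 /= normr_eq0 => /eqP S0p; rewrite -[RHS]S0p; apply: eq_bigr => i _.
  by rewrite !mxE mulrC mulrA.
have /colP/(_ i0) : d = 0 by rewrite -(mulKmx V_unit d) Vd mulmx0.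
by rewrite !mxE => /eqP; rewrite mulf_eq0 (negPf (f_neq0 _)) orbF.
Qed.

(** * Passage to the limit in Hermitian forms *)

Section Limit.
Context {R : realType}.
Local Open Scope complex_scope.
Local Open Scope classical_set_scope.
Local Open Scope ring_scope.

(** Here [f] stands for the real or the imaginary part, so that all limits are taken in [R]. *)
Lemma hform_cvg {I : finType} (c : I -> R[i]) (A_ : nat -> I -> I -> R)
    (A : I -> I -> R) (f : R[i] -> R) :
  {morph f : x y / x + y} -> (forall z a, f (z * a%:C) = f z * a) ->
  (forall i j, A_ N i j @[N --> \oo] --> A i j) ->
  f (hform c (fun i j => (A_ N i j)%:C)) @[N --> \oo] -->
    f (hform c (fun i j => (A i j)%:C)).
Proof.
move=> fD fM A_cvg.
have f0 : f 0 = 0 by rewrite -(mulr0 0) (fM 0 0) mulr0.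
have hformE (B : I -> I -> R) : f (hform c (fun i j => (B i j)%:C)) =
    \sum_i \sum_j f (c i * (c j)^*) * B i j.
  rewrite (big_morph f fD f0); apply: eq_bigr => i _.
  by rewrite (big_morph f fD f0); apply: eq_bigr => j _; rewrite fM.
under eq_fun do rewrite hformE.
rewrite hformE; apply: (cvg_big add_continuous) => i _.
apply: (cvg_big add_continuous) => j _.
by apply: cvgM; [exact: cvg_cst|exact: A_cvg].
Qed.

(** In [R[i]], z <= w means equal imaginary parts and ordered real parts. Both pass to the limit,
    the equality as two opposite inequalities. *)
Lemma le_hform_lim {I : finType} (c : I -> R[i]) (A_ : nat -> I -> I -> R)
    (A : I -> I -> R) (z : R[i]) :
  (forall i j, A_ N i j @[N --> \oo] --> A i j) ->
  (\forall N \near \oo, z <= hform c (fun i j => (A_ N i j)%:C)) ->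
  z <= hform c (fun i j => (A i j)%:C).
Proof.
move=> A_cvg le_z.
have Re_cvg := hform_cvg c _ _ (@complex.Re R) _ _ A_cvg.
have Im_cvg := hform_cvg c _ _ (@complex.Im R) _ _ A_cvg.
rewrite lecE; apply/andP; split.
  rewrite eq_le; apply/andP; split.
    apply: (cvgr_to_le (Im_cvg _ _)) => [[a b] [d e]//|[a b] d /=|].
      by rewrite mulr0 add0r.
    by apply: filterS le_z => N; rewrite lecE => /andP[/eqP->].
  apply: (cvgr_to_ge (Im_cvg _ _)) => [[a b] [d e]//|[a b] d /=|].
    by rewrite mulr0 add0r.
  by apply: filterS le_z => N; rewrite lecE => /andP[/eqP->].
apply: (cvgr_to_ge (Re_cvg _ _)) => [[a b] [d e]//|[a b] d /=|].
  by rewrite mulr0 subr0.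
by apply: filterS le_z => N; rewrite lecE => /andP[].
Qed.

(** * The real-valued modulus and the geometric series *)

Lemma modulusE (z : R[i]) : (modulus z)%:C = `|z|.
Proof. by rewrite /modulus RRe_real// normr_real. Qed.

Lemma modulus_sqr (z : R[i]) : (modulus z ^+ 2)%:C = z * z^*%R.
Proof. by rewrite rmorphXn /= modulusE normCK. Qed.

Lemma modulus_lt1 (z : R[i]) : (modulus z < 1) = (`|z| < 1).
Proof. by rewrite -modulusE -ltcR. Qed.

Lemma modulus_ge0 (z : R[i]) : 0 <= modulus z.
Proof. by rewrite -lecR modulusE normr_ge0. Qed.

Lemma modulusM : {morph @modulus R : x y / x * y}.
Proof. by move=> x y; apply: complexI; rewrite rmorphM /= !modulusE normrM. Qed.

Lemma modulusX n : {morph @modulus R : x / x ^+ n}.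
Proof. by move=> x; apply: complexI; rewrite rmorphXn /= !modulusE normrX. Qed.

Lemma modulus_geometric_cvg (z : R[i]) : `|z| < 1 ->
  modulus (\sum_(p < N) z ^+ p) ^+ 2 @[N --> \oo] --> (modulus (1 - z) ^+ 2)^-1.
Proof.
move=> z_lt1.
have nz : 1 - z != 0.
  by rewrite subr_eq0 eq_sym; apply: contraTneq z_lt1 => ->; rewrite normr1 ltxx.
have nm : modulus (1 - z) != 0 by rewrite -(inj_eq (@complexI R)) modulusE normr_eq0.
have geomE N : modulus (\sum_(p < N) z ^+ p) ^+ 2 =
    modulus (1 - z ^+ N) ^+ 2 * (modulus (1 - z) ^+ 2)^-1.
  apply: (canRL (mulfK _)); first by rewrite expf_neq0.
  rewrite -exprMn -modulusM; congr (modulus _ ^+ 2).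
  by rewrite mulrC -[1 - z]opprB mulNr -subrX1 opprB.
under eq_fun do rewrite geomE.
(* By the closed form, only |1 - z^N| still depends on N; it is squeezed between 1 - |z|^N and 1 +
   |z|^N. *)
suff m_cvg : modulus (1 - z ^+ N) @[N --> \oo] --> (1 : R).
  under eq_fun do rewrite expr2.
  rewrite -[X in nbhs X]mul1r; apply: cvgM (cvg_cst _).
  by rewrite -(mulr1 (1 : R)); apply: cvgM.
have pow_cvg : modulus z ^+ N @[N --> \oo] --> (0 : R).
  by apply: cvg_expr; rewrite ger0_norm ?modulus_ge0 // modulus_lt1.
have lo : 1 - modulus z ^+ N @[N --> \oo] --> (1 : R).
  by rewrite -{2}(subr0 (1 : R)); apply: cvgB pow_cvg; apply: cvg_cst.
have hi : 1 + modulus z ^+ N @[N --> \oo] --> (1 : R).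
  by rewrite -{2}(addr0 (1 : R)); apply: cvgD pow_cvg; apply: cvg_cst.
apply: squeeze_cvgr lo hi; apply: nearW => N.
rewrite -modulusX -!lecR rmorphB rmorphD rmorph1 /= !modulusE.
rewrite -{1}(normr1 R[i]) lerB_dist /=.
by rewrite -{2}(normr1 R[i]) ler_normB.
Qed.

Lemma hform_exp_normsq_szego_ge n (c u : 'I_n -> R[i]) (f : 'I_n -> R) :
  (forall i, `|u i| < 1) ->
  \sum_(p < n) `|\sum_i c i * ((f i)%:C * u i ^+ p)| ^+ 2 <=
  hform c (fun i j =>
    (expR (f i * f j / modulus (1 - u i * (u j)^*%R) ^+ 2))%:C).
Proof.
move=> u_lt1.
set g := fun i => (f i)%:C.
pose B i j := \sum_(p < n) (g i * u i ^+ p) * (g j * u j ^+ p)^*%R.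
have -> : \sum_(p < n) `|\sum_i c i * (g i * u i ^+ p)| ^+ 2 = hform c B.
  by rewrite hform_sum; apply: eq_bigr => p _; rewrite hform_rank1.
pose P N i j := f i * f j * modulus (szego u N i j) ^+ 2.
have PE N i j :
    g i * (g j)^*%R * (szego u N i j * (szego u N i j)^*%R) = (P N i j)%:C.
  by rewrite /P rmorphM /= modulus_sqr rmorphM /= [(g j)^*%R]conjc_real.
(* Two nested limits: first the length N of the geometric sums, then, for fixed N, the length M of
   the exponential sums. The bound [B] depends on neither. *)
apply: (le_hform_lim c (fun N i j => expR (P N i j))) => [i j|].
  apply: continuous_cvg; first exact: continuous_expR.
  apply: cvgM; first exact: cvg_cst.
  apply: modulus_geometric_cvg; rewrite normrM norm_conjC.
  by rewrite mulr_ilt1 ?normr_ge0.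
(* Taking N > n keeps the first n geometric terms and also makes N positive when n = 0. *)
exists n.+1 => // N /= lt_nN.
apply: (le_hform_lim c (fun M i j => series (exp_coeff (P N i j)) M)) => [i j|].
  exact: is_cvg_series_exp_coeff.
exists 2%N => // M /= M_gt1.
rewrite -subr_ge0 -hformB; apply: hform_ge0.
have gP : gram (fun i j => (P N i j)%:C).
  by apply: eq_gram (gram_normsq_szego g u N) => i j.
have gPB : gram (fun i j => (P N i j)%:C - B i j).
  apply: eq_gram (gram_normsq_szegoB g u n N (ltnW lt_nN) _) => [i j|].
    by rewrite PE.
  exact: leq_ltn_trans lt_nN.
apply: eq_gram (gram_exp_sumB _ _ M gP gPB M_gt1) => i j.
congr (_ - _); rewrite /series /= big_mkord rmorph_sum.
by apply: eq_bigr => k _; rewrite [RHS]rmorphM /= rmorphXn /= fmorphV /= rmorph_nat.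
Qed.

(** * The kernel K_t *)

Lemma Kt_sym (t : R) (l m : unit_disk R) : Kt t l m = Kt t m l.
Proof.
rewrite /Kt; congr (expR (- t * _ ^+ 2))%:C.
rewrite /modulus !normrM !normfV distrC; congr (complex.Re (_ / _)).
by rewrite -norm_conjC rmorphB rmorphM rmorph1 /= conjCK mulrC.
Qed.

Lemma Kt_exp (t : R) (l m : unit_disk R) (f := fun z : unit_disk R =>
    Num.sqrt t * (1 - modulus (val z) ^+ 2)) : 0 <= t ->
  Kt t l m = (expR (- t))%:C *
    (expR (f l * f m / modulus (1 - val l * (val m)^*%R) ^+ 2))%:C.
Proof.
move=> t_ge0; rewrite /Kt -rmorphM -expRD; congr ((expR _)%:C).
rewrite {}/f mulrACA -expr2 sqr_sqrtr //.
case: l m => [l l_lt1] [m m_lt1] /=.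
rewrite [m^*%R * l]mulrC.
have nz : 1 - l * m^*%R != 0.
  rewrite subr_eq0; apply/eqP => /(congr1 Num.norm).
  rewrite normr1 normrM norm_conjC => lm1.
  by have := mulr_ilt1 (normr_ge0 l) (normr_ge0 m) l_lt1 m_lt1; rewrite -lm1 ltxx.
have nzc : 1 - l^*%R * m != 0.
  by rewrite -conjC_eq0 rmorphB rmorph1 rmorphM /= conjCK.
(* With each squared modulus written as z z^*, the equality of exponents is a rational identity in
   l, m and their conjugates, whose denominators were just shown nonzero. *)
apply: complexI.
rewrite !(rmorphXn, rmorphM, rmorphN, rmorphD, rmorph1, fmorphV) /= !modulusE.
rewrite !normCK !(rmorphM, rmorphN, rmorphD, rmorph1, fmorphV) /= !conjCK.
by field; rewrite nz nzc.
Qed.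

End Limit.

Theorem mainTheorem4 (R : realType) (t : R) (t_gt0 : 0 < t) :
  strictly_positive_definite (Kt t).
Proof.
pose f (z : unit_disk R) := Num.sqrt t * (1 - modulus (val z) ^+ 2).
pose S n (x : 'I_n -> unit_disk R) (c : 'I_n -> R[i]) :=
  \sum_(p < n) `|\sum_i c i * ((f (x i))%:C%C * val (x i) ^+ p)| ^+ 2.
have exp_gt0 : 0 < (expR (- t))%:C%C by rewrite ltcR expR_gt0.
(* This bound holds for arbitrary points and coefficients, so it yields both nonnegativity and, once
   [S] is positive, strictness. *)
have lower n (x : 'I_n -> unit_disk R) (c : 'rV[R[i]]_n) :
    (expR (- t))%:C%C * S n x (c 0) <=
    \sum_(i < n) \sum_(j < n) c 0 i * (c 0 j)^* * Kt t (x i) (x j).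
  have -> : \sum_(i < n) \sum_(j < n) c 0 i * (c 0 j)^* * Kt t (x i) (x j) =
      (expR (- t))%:C%C * hform (c 0) (fun i j => (expR (f (x i) * f (x j) /
        modulus (1 - val (x i) * (val (x j))^*) ^+ 2))%:C%C).
    rewrite -hformZ; apply: (eq_hform (c 0)) => i j.
    exact: Kt_exp (ltW t_gt0).
  rewrite ler_pM2l //.
  apply: (hform_exp_normsq_szego_ge n (c 0) (val \o x) (f \o x)) => i.
  exact: (valP (x i)).
split; first split.
- by move=> x y; rewrite Kt_sym /Kt [RHS]conjc_real.
- move=> n x c _; apply: le_trans (lower n x c).
  by rewrite mulr_ge0 ?(ltW exp_gt0) // sumr_ge0 // => p _; rewrite exprn_ge0.
move=> n x c _ x_inj c_neq0; apply: lt_le_trans (lower n x c).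
rewrite mulr_gt0 //; apply: moments_gt0 => [||].
- by apply: inj_comp x_inj; exact: val_inj.
(* The weight is nonzero because t > 0 and the points lie in the open disk. *)
- move=> i; rewrite (inj_eq (@complexI R) _ 0) mulf_neq0 //.
    by rewrite gt_eqF ?sqrtr_gt0.
  by rewrite subr_eq0 eq_sym lt_eqF // expr_lt1 ?modulus_ge0 // modulus_lt1 (valP (x i)).
by apply/rV0Pn.
Qed.
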